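(* Let $p$ be an odd prime and let $X$ be a graph on $p$ vertices. If proper Laplacian fractional revival occurs on $X$, then $X$ is a double cone.
   Context: For a graph $X$ with adjacency matrix $A$ and diagonal degree matrix $D$, the Laplacian is $L=D-A$ and the transition matrix is $U(t)=\exp(itL)$. $X$ admits Laplacian fractional revival from vertex $a$ to vertex $b\neq a$ at time $\tau$ if $U(\tau)e_a=\alpha e_a+\beta e_b$ for some complex $\alpha,\beta$; it is proper if $\beta\neq0$. The join $X+Y$ of graphs $X,Y$ is obtained from their disjoint union by joining every vertex of $X$ to every vertex of $Y$. A double cone is a graph of the form $\overline{K_2}+Y$ (two non-adjacent vertices, called the conical vertices, joined to every vertex of a graph $Y$).
   Formalization: X is also assumed connected; without this the claim fails: K_2 together with p−2 isolated vertices has proper Laplacian fractional revival at time π/2 but is not a double cone, since double cones on at least 3 vertices are connected. *)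

(* Defs.v *)
From HB Require Import structures.
From mathcomp Require Import all_boot all_order all_algebra.
From mathcomp Require Import complex.
From mathcomp Require Import all_classical all_reals all_analysis.
Import Order.TTheory GRing.Theory Num.Theory numFieldNormedType.Exports.

Set Implicit Arguments.
Unset Strict Implicit.
Unset Printing Implicit Defensive.

Local Open Scope ring_scope.
Local Open Scope classical_set_scope.

(* The library does not attach the topology of the modulus to R[i] itself, only
   to the regular module K^o of a numFieldType K. *)
HB.instance Definition _ (R : realType) :=
  NormedModule.copy R[i] (R[i] : numFieldType)^o.
HB.instance Definition _ (R : realType) :=
  Pointed.copy R[i] (R[i] : numFieldType)^o.

Record sgraph (V : finType) := SGraph {
  adj :> rel V;
  adj_sym : symmetric adj;
  adj_irr : irreflexive adj }.

Definition graph_connected (V : finType) (X : sgraph V) : Prop :=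
  forall x y : V, connect X x y.

Definition graph_iso (V W : finType) (X : sgraph V) (Y : sgraph W) : Prop :=
  exists f : V -> W, bijective f /\ forall x y, Y (f x) (f y) = X x y.

Section CompleteGraph.
Variable n : nat.

Definition complete_adj : rel 'I_n := fun x y => x != y.

Lemma complete_adj_sym : symmetric complete_adj.
Proof. by move=> x y; rewrite /complete_adj eq_sym. Qed.

Lemma complete_adj_irr : irreflexive complete_adj.
Proof. by move=> x; rewrite /complete_adj eqxx. Qed.

Definition complete_graph : sgraph 'I_n :=
  SGraph complete_adj_sym complete_adj_irr.
End CompleteGraph.

Section ComplementGraph.
Variables (V : finType) (X : sgraph V).

Definition compl_adj : rel V := fun x y => (x != y) && ~~ X x y.

Lemma compl_adj_sym : symmetric compl_adj.
Proof. by move=> x y; rewrite /compl_adj eq_sym adj_sym. Qed.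

Lemma compl_adj_irr : irreflexive compl_adj.
Proof. by move=> x; rewrite /compl_adj eqxx. Qed.

Definition compl_graph : sgraph V := SGraph compl_adj_sym compl_adj_irr.
End ComplementGraph.

Section JoinGraph.
Variables (V W : finType) (X : sgraph V) (Y : sgraph W).

Definition join_adj : rel (V + W)%type := fun u v =>
  match u, v with
  | inl x, inl x' => X x x'
  | inr y, inr y' => Y y y'
  | _, _ => true
  end.

Lemma join_adj_sym : symmetric join_adj.
Proof. by move=> [x|y] [x'|y'] //=; rewrite adj_sym. Qed.

Lemma join_adj_irr : irreflexive join_adj.
Proof. by move=> [x|y] /=; rewrite adj_irr. Qed.

Definition join_graph : sgraph (V + W)%type := SGraph join_adj_sym join_adj_irr.
End JoinGraph.

Definition double_cone (V : finType) (X : sgraph V) : Prop :=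
  exists (W : finType) (Y : sgraph W),
    graph_iso X (join_graph (compl_graph (complete_graph 2)) Y).

(* Matrices of a graph on V are indexed by 'I_#|V| through the bijections
   enum_val / enum_rank. *)
Section GraphMatrices.
Variables (K : pzRingType) (V : finType) (X : sgraph V).

Definition adjacency_mx : 'M[K]_#|V| :=
  \matrix_(i, j) (X (enum_val i) (enum_val j))%:R.

Definition degree (x : V) : nat := #|[set y | X x y]%SET|.

Definition degree_mx : 'M[K]_#|V| :=
  diag_mx (\row_i (degree (enum_val i))%:R).

Definition laplacian_mx : 'M[K]_#|V| := degree_mx - adjacency_mx.
End GraphMatrices.

Definition vertex_vec (K : pzRingType) (V : finType) (a : V) : 'cV[K]_#|V| :=
  delta_mx (enum_rank a) 0.

Definition mxexp (R : realType) (n : nat) (A : 'M[R[i]]_n) : 'M[R[i]]_n :=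
  limn (series (fun k => (k`!%:R : R[i])^-1 *: A ^+ k)).

Definition transition_mx (R : realType) (V : finType) (X : sgraph V) (t : R) :
    'M[R[i]]_#|V| :=
  mxexp (('i * t%:C)%C *: laplacian_mx R[i] X).

(* LFR: Laplacian fractional revival from a to b at time tau. *)
Definition LFR (R : realType) (V : finType) (X : sgraph V)
    (a b : V) (tau : R) (alpha beta : R[i]) : Prop :=
  a != b /\
  transition_mx X tau *m vertex_vec R[i] a =
    alpha *: vertex_vec R[i] a + beta *: vertex_vec R[i] b.

Definition proper_LFR (R : realType) (V : finType) (X : sgraph V)
    (a b : V) (tau : R) : Prop :=
  exists alpha beta : R[i], LFR X a b tau alpha beta /\ beta != 0.

(* Main.v *)
Require Import Defs.
From mathcomp Require Import all_boot all_order all_algebra.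
From mathcomp Require Import algC algnum.
From mathcomp Require Import complex.
From mathcomp Require Import all_classical all_reals all_analysis.
From mathcomp Require Import ring lra.
Import Order.TTheory GRing.Theory Num.Theory numFieldNormedType.Exports.

Set Implicit Arguments.
Unset Strict Implicit.
Unset Printing Implicit Defensive.

Local Open Scope ring_scope.

(* Write L for the Laplacian, U = exp(i tau L), n for the number of vertices.
   U is unitary and symmetric with row sums 1, so revival between a and b forces
   U w = w and U v = zeta v with zeta != 1, for w = e_a + e_b and v = e_a - e_b.
   The rational vectors fixed by U form an L-stable subspace containing w, and the
   eigenvalues r of L on it satisfy exp(i tau r) = 1, i.e. they are multiples of
   2 pi / tau; as they are nonnegative with rational sum, 2 pi / tau is rational, and
   the eigenvalues are integers.
   Applying \prod_{r != 0} (L - r) to w yields an integral vector in the kernel of L,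
   a multiple of the all-ones vector, so the odd prime n divides some nonzero r;
   since r <= n, n is one of these eigenvalues. A further eigenvalue 0 < r < n would be
   coprime to n, whence exp(i tau) = 1; the same rationality argument makes the
   eigenvalues of L on the rational vectors x with U x = zeta x integral, so zeta = 1,
   a contradiction. Hence w L (L - n) = 0, which says that every other vertex is
   adjacent to both a and b; if a and b were adjacent too, v would be an eigenvector
   for n and zeta would be 1. *)

(** * Exponential of a diagonalizable matrix *)

Lemma conj_diag_exp (K : fieldType) n (P : 'M[K]_n) (d : 'rV[K]_n) k :
  P \in unitmx ->
  (invmx P *m diag_mx d *m P) ^+ k = invmx P *m diag_mx (map_mx (fun x => x ^+ k) d) *m P.
Proof.
move=> P_unit; elim: k => [|k IHk].
  rewrite expr0 (_ : map_mx _ d = const_mx 1); last by apply/rowP => j; rewrite !mxE expr0.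
  by rewrite diag_const_mx mulmx1 mulVmx.
rewrite exprS IHk.
transitivity (invmx P *m (diag_mx d *m diag_mx (map_mx (fun x => x ^+ k) d)) *m P).
  rewrite -[_ * _]/(_ *m _) !mulmxA; congr (_ *m _ *m _).
  by rewrite mulmxK.
rewrite mulmx_diag; congr (_ *m diag_mx _ *m _).
by apply/rowP => j; rewrite !mxE exprS.
Qed.

Lemma conj_diagZ (K : fieldType) n (P : 'M[K]_n) (d : 'rV[K]_n) c :
  c *: (invmx P *m diag_mx d *m P) = invmx P *m diag_mx (c *: d) *m P.
Proof. by rewrite linearZ -scalemxAr -scalemxAl. Qed.

Lemma conj_diag_series (K : fieldType) n (P : 'M[K]_n) (d : 'rV[K]_n)
    (c : nat -> K) m :
  P \in unitmx ->
  \sum_(0 <= k < m) c k *: (invmx P *m diag_mx d *m P) ^+ k =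
  invmx P *m diag_mx (\row_j \sum_(0 <= k < m) c k * d 0 j ^+ k) *m P.
Proof.
move=> P_unit; under eq_bigr do rewrite conj_diag_exp // conj_diagZ.
rewrite -mulmx_suml -mulmx_sumr -linear_sum; congr (_ *m diag_mx _ *m _).
by apply/rowP => j; rewrite summxE mxE; apply: eq_bigr => k _; rewrite !mxE.
Qed.

Lemma cvg_conj_diag (K : numFieldType) n (P Q : 'M[K]_n) (s : nat -> 'rV[K]_n)
    (e : 'rV[K]_n) i j :
  (forall k, ((fun m => s m 0 k : K^o) @ \oo --> (e 0 k : K^o))%classic) ->
  ((fun m => (Q *m diag_mx (s m) *m P) i j : K^o) @ \oo -->
    ((Q *m diag_mx e *m P) i j : K^o))%classic.
Proof.
move=> se; have entE (d : 'rV[K]_n) : (Q *m diag_mx d *m P) i j =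
    \sum_k Q i k * d 0 k * P k j.
  by rewrite mxE; apply: eq_bigr => k _; rewrite mul_mx_diag mxE.
rewrite entE; under eq_fun do rewrite entE.
apply: (@cvg_big K^o); first exact: add_continuous.
by move=> k _; apply: cvgMr_tmp; apply: cvgMl_tmp; exact: se.
Qed.

Section MatrixExponential.
Variable R : realType.

Definition expi (t : R) : R[i] := (cos t +i* sin t)%C.

Lemma expi0 : expi 0 = 1.
Proof. by rewrite /expi cos0 sin0. Qed.

Lemma expiD s t : expi (s + t) = expi s * expi t.
Proof. by rewrite /expi cosD sinD; simpc; congr (_ +i* _)%C; rewrite addrC. Qed.

Lemma norm_expi t : `|expi t| = 1.
Proof. by rewrite normc_def /= cos2Dsin2 sqrtr1. Qed.

Lemma expi_neq0 t : expi t != 0.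
Proof. by rewrite -normr_eq0 norm_expi oner_neq0. Qed.

Lemma expiMz t (m : int) : expi t = 1 -> expi (t * m%:~R) = 1.
Proof.
move=> t1; have nat1 n : expi (t * n%:R) = 1.
  elim: n => [|n IHn]; first by rewrite mulr0 expi0.
  by rewrite -natr1 mulrDr mulr1 expiD IHn t1 mul1r.
case: m => n; first exact: nat1.
rewrite NegzE mulrNz mulrN; apply: (mulIf (expi_neq0 (t * n.+1%:R))).
by rewrite -expiD addNr expi0 nat1 mul1r.
Qed.

(** Reducing modulo [2 pi] leaves [s] with [0 <= s < 2 pi]. A nonzero [s] would make [sin (s / 2)]
    positive, while [cos s = 1] forces [cos (s / 2)] to be [1] or [-1], so [sin (s / 2) = 0]. *)
Lemma expi_eq1 t : expi t = 1 -> exists k : int, t = pi *+ 2 * k%:~R.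
Proof.
move=> t1; have pi_gt0 := @pi_gt0 R; pose k := Num.floor (t / (pi *+ 2)).
have pi2_gt0 : 0 < pi *+ 2 :> R by rewrite pmulrn_lgt0.
exists k; pose s := t - pi *+ 2 * k%:~R.
have pi21 : expi (pi *+ 2) = 1 by rewrite /expi cos2pi sin2pi.
have s1 : expi s = 1 by rewrite expiD t1 -mulrN -mulrNz expiMz // mul1r.
have s_ge0 : 0 <= s.
  by rewrite subr_ge0 -ler_pdivlMl // mulrC floor_le_tmp.
have s_lt : s < pi *+ 2.
  rewrite ltrBlDl -[X in _ + X]mulr1 -mulrDr -ltr_pdivrMl // mulrC -(intrD _ k 1).
  exact: floorD1_gt.
apply/eqP; rewrite -subr_eq0 -/s; apply: contraT => s_neq0.
have /sin_gt0_pi : 0 < s / 2 < pi.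
  have s_gt0 : 0 < s by rewrite lt_def s_neq0.
  by apply/andP; split; lra.
suff -> : sin (s / 2) = 0 by rewrite ltxx.
apply: cos1sin0; apply/eqP; rewrite -sqrp_eq1 ?normr_ge0 // real_normK ?num_real //.
have [cs _] : cos s = 1 /\ sin s = 0 by case: s1.
have := cos_mulr2n (s / 2); rewrite -[_ *+ 2 in LHS]mulr_natr divfK ?pnatr_eq0 // cs.
by move=> E; apply/eqP; lra.
Qed.

Lemma cvg_complex (u v : nat -> R) (a b : R) :
  (u @ \oo --> a)%classic -> (v @ \oo --> b)%classic ->
  ((fun n => (u n +i* v n)%C : R[i]) @ \oo --> (a +i* b)%C)%classic.
Proof.
move=> ua vb; apply/cvgrPdist_lt => e e_gt0.
have [r re] : exists r, e = r%:C%C by apply/complex_realP; rewrite ger0_real ?ltW.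
move: e_gt0; rewrite re ltcR => r_gt0.
move/cvgrPdist_lt: ua => /(_ (r / 2)) ua; move/cvgrPdist_lt: vb => /(_ (r / 2)) vb.
near=> n.
have -> : ((a +i* b) - (u n +i* v n))%C = (a - u n)%:C%C + 'i%C * (b - v n)%:C%C.
  by simpc.
apply: (le_lt_trans (ler_normD _ _)); rewrite normrM.
have -> : `|'i%C : R[i]| = 1 by rewrite normc_def /= expr0n add0r expr1n sqrtr1.
rewrite mul1r !normc_def /= !expr0n !addr0 !sqrtr_sqr -rmorphD ltcR [ltRHS]splitr.
by apply: ltrD; near: n; [apply: ua|apply: vb]; rewrite divr_gt0.
Unshelve. all: by end_near. Qed.

Lemma expi_series (t : R) n :
  series (fun k => (k`!%:R : R[i])^-1 * ('i%C * t%:C%C) ^+ k) n =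
  (series (cos_coeff t) n +i* series (sin_coeff t) n)%C.
Proof.
have mkE (x y : R) : (x +i* y)%C = x%:C%C + 'i%C * y%:C%C by simpc.
rewrite /series /cos_coeff /sin_coeff /= [RHS]mkE !rmorph_sum mulr_sumr -big_split.
apply: eq_bigr => k _; cbv beta.
have -> : (k`!%:R : R[i])^-1 = (k`!%:R^-1)%:C%C by rewrite fmorphV rmorph_nat.
rewrite exprMn -rmorphXn /=.
have i2 m : ('i%C : R[i]) ^+ m.*2 = ((-1) ^+ m)%:C%C.
  by rewrite -mul2n exprM sqr_i rmorphXn rmorphN1.
(* Terms are matched by parity: an even power of ['i] is real and gives the cosine coefficient, an
   odd one keeps a factor ['i] and gives the sine coefficient. *)
rewrite -[X in 'i%C ^+ X](odd_double_half k); case: (boolP (odd k)) => [k_odd|k_even] /=.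
  rewrite add1n exprS i2 !mul0r add0r !mul1r !rmorphM /=.
  have -> : k.-1./2 = k./2 by rewrite -[in LHS](odd_double_half k) k_odd add1n /= doubleK.
  by ring.
by rewrite add0n i2 !mul0r mulr0 addr0 !mul1r !rmorphM /=; ring.
Qed.

Lemma cvg_expi_series (t : R) :
  (series (fun k => (k`!%:R : R[i])^-1 * ('i%C * t%:C%C) ^+ k) @ \oo --> expi t)%classic.
Proof.
rewrite (_ : series _ = fun n => (series (cos_coeff t) n +i* series (sin_coeff t) n)%C);
  last by apply/funext => n; exact: expi_series.
apply: cvg_complex.
- by rewrite cos.unlock; exact: is_cvg_series_cos_coeff.
- by rewrite sin.unlock; exact: is_cvg_series_sin_coeff.
Qed.

(** A neighbourhood of a matrix contains a product of neighbourhoods of its entries, and finitely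
    many eventual conditions hold simultaneously. *)
Lemma mx_cvg m n (F : nat -> 'M[R[i]]_(m, n)) (M : 'M[R[i]]_(m, n)) :
  (forall i j, ((fun k => F k i j) @ \oo --> M i j)%classic) ->
  (F @ \oo --> M)%classic.
Proof.
move=> FM A [Q MQ QA].
have : (\forall k \near \oo, forall i j, Q i j (F k i j))%classic.
  by apply: filter_forall => i; apply: filter_forall => j; apply: FM (MQ i j).
by apply: filterS => k ?; exact: QA.
Qed.

Lemma mxexp_diag n (A P : 'M[R[i]]_n) (z e : 'rV[R[i]]_n) :
  P \in unitmx -> A = invmx P *m diag_mx z *m P ->
  (forall j, (series (fun k => (k`!%:R)^-1 * z 0 j ^+ k) @ \oo --> e 0 j)%classic) ->
  mxexp A = invmx P *m diag_mx e *m P.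
Proof.
move=> P_unit -> ze; rewrite /mxexp; apply/cvg_lim; first exact: norm_hausdorff.
pose s k := \row_j series (fun k => (k`!%:R)^-1 * z 0 j ^+ k) k.
rewrite (_ : series _ = fun k => invmx P *m diag_mx (s k) *m P); last first.
  by apply/funext => k; exact: conj_diag_series.
apply: mx_cvg => i j; apply: cvg_conj_diag => k.
rewrite (_ : (fun _ => _) = series (fun l => (l`!%:R)^-1 * z 0 k ^+ l)); first exact: ze.
by apply/funext => l; rewrite mxE.
Qed.

Lemma mxexp_imaginary n (A P : 'M[R[i]]_n) (d : 'I_n -> R) (t : R) :
  P \in unitmx -> A = invmx P *m diag_mx (\row_j (d j)%:C%C) *m P ->
  mxexp (('i%C * t%:C%C) *: A) =
  invmx P *m diag_mx (\row_j expi (t * d j)) *m P.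
Proof.
move=> P_unit AE.
apply: (@mxexp_diag _ _ _ (('i%C * t%:C%C) *: \row_j (d j)%:C%C) _ P_unit).
  rewrite AE; exact: conj_diagZ.
by move=> j; rewrite !mxE -[_ * _ * _]mulrA -rmorphM; exact: cvg_expi_series.
Qed.

End MatrixExponential.

(** * Graph Laplacian *)

Section Laplacian.
Variables (V : finType) (X : sgraph V).
Local Notation n := #|V|.
Local Notation a := (fun i j : 'I_n => X (enum_val i) (enum_val j)).

Lemma natr_degree (K : pzRingType) (i : 'I_n) :
  (degree X (enum_val i))%:R = \sum_j (a i j)%:R :> K.
Proof.
rewrite /degree -sum1_card natr_sum (reindex_onto enum_val enum_rank) /=; last first.
  by move=> x _; rewrite enum_rankK.
rewrite [RHS](bigID (a i)) /= [X in _ = _ + X]big1 ?addr0; last first.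
  by move=> j /negPf ->.
under [RHS]eq_bigr => j -> do [].
by apply: eq_bigl => j; rewrite inE enum_valK eqxx andbT.
Qed.

Lemma laplacian_mxE (K : pzRingType) (i j : 'I_n) :
  laplacian_mx K X i j = (degree X (enum_val i))%:R *+ (i == j) - (a i j)%:R.
Proof. by rewrite !mxE. Qed.

Lemma map_laplacian (K K' : pzRingType) (f : {rmorphism K -> K'}) :
  map_mx f (laplacian_mx K X) = laplacian_mx K' X.
Proof.
by apply/matrixP => i j; rewrite mxE !laplacian_mxE rmorphB rmorphMn !rmorph_nat.
Qed.

Lemma tr_laplacian (K : pzRingType) : (laplacian_mx K X)^T = laplacian_mx K X.
Proof.
apply/matrixP => i j; rewrite mxE !laplacian_mxE adj_sym eq_sym; congr (_ - _).
by case: eqP => [->|].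
Qed.

Lemma mul_laplacian (K : comPzRingType) (y : 'rV[K]_n) j :
  (y *m laplacian_mx K X) 0 j = \sum_i (a i j)%:R * (y 0 j - y 0 i).
Proof.
rewrite mxE; under eq_bigr do rewrite laplacian_mxE mulrBr.
rewrite sumrB (bigD1 j) //= big1 => [|i /negPf ->]; last by rewrite mulr0n mulr0.
rewrite addr0 eqxx mulr1n natr_degree mulr_sumr -sumrB; apply: eq_bigr => i _.
by rewrite adj_sym mulrBr; congr (_ - _); rewrite mulrC.
Qed.

Lemma laplacian_const (K : comPzRingType) (c : K) :
  const_mx c *m laplacian_mx K X = 0 :> 'rV_n.
Proof.
by apply/rowP => j; rewrite mul_laplacian big1 ?mxE // => i _; rewrite !mxE subrr mulr0.
Qed.

Lemma laplacian_mul_const (K : comPzRingType) (c : K) :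
  laplacian_mx K X *m const_mx c = 0 :> 'cV_n.
Proof.
by apply: trmx_inj; rewrite trmx_mul tr_laplacian trmx_const laplacian_const trmx0.
Qed.

(** The Dirichlet form, obtained by adding the sum to its copy with the two indices exchanged; the
    factor 2 counts each edge in both directions. *)
Lemma laplacian_form (K : comPzRingType) (y z : 'rV[K]_n) :
  (\sum_j (y *m laplacian_mx K X) 0 j * z 0 j) *+ 2 =
  \sum_j \sum_i (a i j)%:R * ((y 0 j - y 0 i) * (z 0 j - z 0 i)).
Proof.
have formE : \sum_j (y *m laplacian_mx K X) 0 j * z 0 j =
    \sum_j \sum_i (a i j)%:R * (y 0 j - y 0 i) * z 0 j.
  by apply: eq_bigr => j _; rewrite mul_laplacian mulr_suml.
rewrite mulr2n {1}formE formE [X in _ + X]exchange_big -big_split.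
apply: eq_bigr => j _; rewrite -big_split; apply: eq_bigr => i _ /=.
by rewrite (adj_sym X (enum_val j)); ring.
Qed.

(** The Dirichlet form of [y] is a vanishing sum of squares, so [y] is constant along edges, hence
    along paths. *)
Lemma laplacian_ker (F : realDomainType) (y : 'rV[F]_n) :
  graph_connected X -> y *m laplacian_mx F X = 0 -> forall i j, y 0 i = y 0 j.
Proof.
move=> X_conn yL0.
have edge i j : a i j -> y 0 i = y 0 j.
  have := laplacian_form y y; rewrite yL0 big1 => [|k _]; last by rewrite mxE mul0r.
  rewrite mul0rn => /esym/eqP; rewrite psumr_eq0 => [/allP/(_ j)|k _]; last first.
    by apply: sumr_ge0 => l _; rewrite mulr_ge0 -?expr2 ?sqr_ge0.
  rewrite mem_index_enum => /(_ isT)/=; rewrite psumr_eq0 => [/allP/(_ i)|l _]; last first.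
    by rewrite mulr_ge0 -?expr2 ?sqr_ge0.
  rewrite mem_index_enum => /(_ isT)/= + aij; rewrite aij mul1r -expr2 sqrf_eq0 subr_eq0.
  by move/eqP.
have path_eq p x : path X x p -> y 0 (enum_rank x) = y 0 (enum_rank (last x p)).
  elim: p x => //= z p IHp x /andP[xz /IHp <-].
  by apply: edge; rewrite !enum_rankK.
move=> i j; have /connectP[p Xp ij] := X_conn (enum_val i) (enum_val j).
by have := path_eq _ _ Xp; rewrite -ij !enum_valK.
Qed.

End Laplacian.

(** * Complement graph and bounds on Laplacian eigenvalues *)

Section LaplacianCompl.
Variables (V : finType) (X : sgraph V).
Local Notation n := #|V|.

(** The two Laplacians add up to that of the complete graph, [n I - J] with [J] the all-ones
    matrix. *)
Lemma mul_laplacian_compl (K : comPzRingType) (y : 'rV[K]_n) j :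
  (y *m laplacian_mx K X) 0 j + (y *m laplacian_mx K (compl_graph X)) 0 j =
  y 0 j *+ n - \sum_i y 0 i.
Proof.
rewrite !mul_laplacian -big_split /=.
have -> : y 0 j *+ n = \sum_(i < n) y 0 j by rewrite sumr_const card_ord.
rewrite -sumrB; apply: eq_bigr => i _.
rewrite /compl_adj (inj_eq enum_val_inj).
have [->|ij] := eqVneq i j; first by rewrite subrr !mulr0 addr0.
by case: (X _ _) => /=; rewrite ?mul1r ?mul0r ?addr0 ?add0r.
Qed.

(** Pairing [y] with its conjugate in the Dirichlet form equates twice [l] times the squared norm of
    [y] with a sum of nonnegative terms. *)
Lemma laplacian_eigenvalue_ge0 (C : numClosedFieldType) (Y : sgraph V)
    (y : 'rV[C]_n) (l : C) :
  y *m laplacian_mx C Y = l *: y -> y != 0 -> 0 <= l.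
Proof.
move=> yL y_neq0.
have := laplacian_form Y y (map_mx Num.conj y); rewrite yL.
have -> : \sum_j (l *: y) 0 j * (map_mx Num.conj y) 0 j = l * \sum_j `|y 0 j| ^+ 2.
  by rewrite mulr_sumr; apply: eq_bigr => j _; rewrite !mxE normCK mulrA.
have y_gt0 : 0 < \sum_j `|y 0 j| ^+ 2.
  rewrite lt_def sumr_ge0 ?andbT => [|j _]; last by rewrite exprn_ge0.
  apply: contra y_neq0; rewrite psumr_eq0 => [/allP y0|j _]; last by rewrite exprn_ge0.
  apply/eqP/rowP => j; rewrite mxE; apply/eqP; rewrite -normr_eq0 -sqrf_eq0.
  by apply: y0; rewrite mem_index_enum.
move=> formE; rewrite -(pmulr_lge0 _ y_gt0) -(pmulrn_lge0 _ (isT : (0 < 2)%N)) formE.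
apply: sumr_ge0 => j _; apply: sumr_ge0 => i _; apply: mulr_ge0; first exact: ler0n.
by rewrite !mxE -rmorphB -normCK exprn_ge0.
Qed.

(** For [l != 0] the entries of [y] sum to 0, so [y] is an eigenvector of the complement with
    eigenvalue [n - l], which is nonnegative. *)
Lemma laplacian_eigenvalue_le (C : numClosedFieldType) (y : 'rV[C]_n) (l : C) :
  y *m laplacian_mx C X = l *: y -> y != 0 -> l <= n%:R.
Proof.
move=> yL y_neq0; have [->|l_neq0] := eqVneq l 0; first exact: ler0n.
have sum_y : \sum_i y 0 i = 0.
  have : l * \sum_i y 0 i = 0.
    transitivity ((y *m laplacian_mx C X *m (const_mx 1 : 'cV_n)) 0 0).
      by rewrite yL mxE mulr_sumr; apply: eq_bigr => i _; rewrite !mxE mulr1.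
    by rewrite -mulmxA laplacian_mul_const mulmx0 mxE.
  by move/eqP; rewrite mulf_eq0 (negPf l_neq0) => /eqP.
rewrite -subr_ge0; apply: (@laplacian_eigenvalue_ge0 _ (compl_graph X) y) => //.
apply/rowP => j; have := mul_laplacian_compl y j.
by rewrite sum_y yL subr0 !mxE mulrBl mulr_natl => <-; rewrite addrC addKr.
Qed.
End LaplacianCompl.

(** By symmetry, the squared norm of [y *m M] is [y *m M *m M] paired with [y]. *)
Lemma symm_sqr_ker (F : realDomainType) n (M : 'M[F]_n) (y : 'rV_n) :
  M^T = M -> y *m M *m M = 0 -> y *m M = 0.
Proof.
move=> M_sym yMM; apply/rowP => j; rewrite [RHS]mxE; apply/eqP.
have : \sum_j (y *m M) 0 j * (y *m M) 0 j = 0.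
  transitivity ((y *m M *m (y *m M)^T) 0 0).
    by rewrite [RHS]mxE; apply: eq_bigr => i _; congr (_ * _); rewrite [RHS]mxE.
  by rewrite trmx_mul M_sym mulmxA yMM mul0mx mxE.
move/eqP; rewrite psumr_eq0 => [/allP/(_ j)|i _]; last by rewrite -expr2 sqr_ge0.
by rewrite mem_index_enum -expr2 sqrf_eq0 => /(_ isT).
Qed.

(** * Transition matrix and revival *)

(** In the coordinates [y *m invmx P], an eigenvector for [l] is supported where [d] equals [l], and
    there [e] equals [m]. *)
Lemma conj_diag_eigen (K : fieldType) n (P : 'M[K]_n) (d e : 'rV[K]_n)
    (y : 'rV[K]_n) l m :
  P \in unitmx -> y *m (invmx P *m diag_mx d *m P) = l *: y ->
  (forall k, d 0 k = l -> e 0 k = m) ->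
  y *m (invmx P *m diag_mx e *m P) = m *: y.
Proof.
move=> P_unit yd de.
have [z yE] : exists z, y = z *m P by exists (y *m invmx P); rewrite mulmxKV.
have zd : z *m diag_mx d = l *: z.
  by apply: (can_inj (mulmxK P_unit)); rewrite -scalemxAl -yE -yd yE !mulmxA mulmxK.
have ze : z *m diag_mx e = m *: z.
  apply/rowP => k; move/rowP/(_ k): zd; rewrite !mul_mx_diag !mxE mulrC => /eqP.
  have [->|z_neq0 zl] := eqVneq (z 0 k) 0; first by rewrite !mulr0 mul0r.
  by rewrite (de k) 1?mulrC //; apply: (mulIf z_neq0); apply/eqP.
by rewrite {1}yE !mulmxA mulmxK // ze -scalemxAl -yE.
Qed.

Lemma conj_diag_comm (K : fieldType) n (P : 'M[K]_n) (d e : 'rV[K]_n) :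
  P \in unitmx ->
  invmx P *m diag_mx d *m P *m (invmx P *m diag_mx e *m P) =
  invmx P *m diag_mx e *m P *m (invmx P *m diag_mx d *m P).
Proof.
move=> P_unit; rewrite !mulmxA !mulmxK // -!(mulmxA (invmx P)).
by rewrite diag_mxC.
Qed.

(** [P] need not be orthogonal, so transposing gives a different diagonalization. As [e] is a
    function of [d], the matrix of [e] and its transpose still act alike on the rows of [P], which
    are eigenvectors of the symmetric matrix of [d]. *)
Lemma conj_diag_sym (K : fieldType) n (P : 'M[K]_n) (d e : 'rV[K]_n) :
  P \in unitmx -> (forall k l, d 0 k = d 0 l -> e 0 k = e 0 l) ->
  (invmx P *m diag_mx d *m P)^T = invmx P *m diag_mx d *m P ->
  (invmx P *m diag_mx e *m P)^T = invmx P *m diag_mx e *m P.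
Proof.
move=> P_unit de.
have trE (f : 'rV[K]_n) : (invmx P *m diag_mx f *m P)^T =
    invmx (invmx P)^T *m diag_mx f *m (invmx P)^T.
  by rewrite !trmx_mul tr_diag_mx -trmx_inv invmxK mulmxA.
rewrite !trE => symd; apply: (can_inj (mulKmx P_unit)); apply/row_matrixP => k.
have eigen f : row k P *m (invmx P *m diag_mx f *m P) = f 0 k *: row k P.
  rewrite -row_mul !mulmxA mulmxV // mul1mx row_mul.
  by apply/rowP => j; rewrite row_diag_mx -scalemxAl -rowE.
rewrite !row_mul eigen; apply: (conj_diag_eigen (d := d) (l := d 0 k)).
- by rewrite unitmx_tr unitmx_inv.
- by rewrite symd eigen.
- by move=> l; exact: de.
Qed.

Lemma unitary_conj_diag (C : numClosedFieldType) n (P : 'M[C]_n) (e : 'rV[C]_n) :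
  P \is unitarymx -> (forall k, `|e 0 k| = 1) ->
  invmx P *m diag_mx e *m P \is unitarymx.
Proof.
move=> P_unitary e1; rewrite invmx_unitary // mul_unitarymx //.
rewrite mul_unitarymx ?trmxC_unitary //; apply/unitarymxP.
rewrite tr_diag_mx map_diag_mx mulmx_diag -[RHS]diag_const_mx; congr diag_mx.
by apply/rowP => k; rewrite !mxE -normCK e1 expr1n.
Qed.

(** * Spectral form and symmetries of the transition matrix *)

Section Transition.
Variables (R : realType) (V : finType) (X : sgraph V) (t : R).
Local Notation n := #|V|.
Local Notation L := (laplacian_mx R[i] X).
Local Notation U := (transition_mx X t).

Lemma transition_diag : exists (P : 'M[R[i]]_n) (d : 'I_n -> R),
  [/\ P \is unitarymx, L = invmx P *m diag_mx (\row_j (d j)%:C%C) *m P &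
      U = invmx P *m diag_mx (\row_j expi (t * d j)) *m P].
Proof.
have L_herm : L \is hermsymmx.
  apply: realsym_hermsym.
    by apply/is_hermitianmxP; rewrite expr0 scale1r map_mx_id ?tr_laplacian.
  apply/mxOverP => i j; rewrite laplacian_mxE -mulr_natr -natrM.
  by rewrite rpredB ?realn.
have /orthomx_spectralP LE := hermitian_normalmx L_herm.
have /mxOverP d_real := hermitian_spectral_diag_real L_herm.
pose d j := complex.Re (spectral_diag L 0 j).
have dE : spectral_diag L = \row_j (d j)%:C%C.
  by apply/rowP => j; rewrite mxE RRe_real.
rewrite dE in LE; exists (spectralmx L), d; split.
- exact: spectral_unitarymx.
- exact: LE.
- exact: (mxexp_imaginary t (spectral_unit L) LE).
Qed.

Lemma transition_eigen (y : 'rV_n) (l : R) :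
  y *m L = l%:C%C *: y -> y *m U = expi (t * l) *: y.
Proof.
have [P [d [P_unitary -> ->]]] := transition_diag.
move=> yL; apply: conj_diag_eigen yL _; first exact: unitarymx_unit.
by move=> k; rewrite !mxE => /complexI ->.
Qed.

Lemma tr_transition : U^T = U.
Proof.
have := tr_laplacian X R[i]; have [P [d [P_unitary -> ->]]] := transition_diag.
apply: conj_diag_sym; first exact: unitarymx_unit.
by move=> k l; rewrite !mxE => /complexI ->.
Qed.

Lemma transition_unitary : U \is unitarymx.
Proof.
have [P [d [P_unitary _ ->]]] := transition_diag.
by apply: unitary_conj_diag => // k; rewrite mxE norm_expi.
Qed.

Lemma transition_comm : L *m U = U *m L.
Proof.
have [P [d [/unitarymx_unit P_unit -> ->]]] := transition_diag.
exact: conj_diag_comm.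
Qed.
End Transition.

(* The row sums give [alpha + beta = 1], so the orthogonality of rows [i] and [j]
   together with [|alpha|^2 + |beta|^2 = 1] forces [U j j = alpha]; row [j] then has
   no room for any other nonzero entry. *)
Lemma unitary_revival (C : numClosedFieldType) n (U : 'M[C]_n) i j alpha beta :
  U \is unitarymx -> U^T = U -> U *m const_mx 1 = const_mx 1 :> 'cV_n ->
  i != j -> beta != 0 ->
  U *m delta_mx i 0 = alpha *: delta_mx i 0 + beta *: delta_mx j 0 :> 'cV_n ->
  [/\ alpha + beta = 1,
      delta_mx 0 i *m U = alpha *: delta_mx 0 i + beta *: delta_mx 0 j :> 'rV_n &
      delta_mx 0 j *m U = beta *: delta_mx 0 i + alpha *: delta_mx 0 j :> 'rV_n].
Proof.
move=> U_unitary U_sym U1 ij beta0 Ui.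
have ji : (j == i) = false by rewrite eq_sym (negPf ij).
have row_i : delta_mx 0 i *m U = alpha *: delta_mx 0 i + beta *: delta_mx 0 j :> 'rV_n.
  by apply: trmx_inj; rewrite trmx_mul U_sym trmx_delta Ui linearD !linearZ /= !trmx_delta.
have Ui_ k : U i k = alpha *+ (k == i) + beta *+ (k == j).
  have /rowP/(_ k) := row_i; rewrite -rowE !mxE eqxx /= => ->.
  by rewrite !mulr_natr.
have [Uii Uij] : U i i = alpha /\ U i j = beta.
  by rewrite !Ui_ !eqxx ji (negPf ij) !mulr0n !mulr1n addr0 add0r.
have sumE (F : 'I_n -> C) : \sum_k U i k * F k = alpha * F i + beta * F j.
  rewrite (bigD1 i) //= (bigD1 j) ?ji //= big1 ?addr0 ?Uii ?Uij // => k /andP[ki kj].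
  by rewrite Ui_ (negPf ki) (negPf kj) addr0 mul0r.
have orth k l : \sum_m U k m * (U l m)^* = (k == l)%:R.
  have /unitarymxP/matrixP/(_ k l) := U_unitary; rewrite !mxE => <-.
  by apply: eq_bigr => m _; rewrite !mxE.
have ab1 : alpha + beta = 1.
  have /matrixP/(_ i 0) := U1; rewrite !mxE.
  by under eq_bigr do rewrite mxE; rewrite sumE !mulr1.
have norm1 : alpha * alpha^* + beta * beta^* = 1.
  by have := orth i i; rewrite sumE Uii Uij eqxx.
(* Expand [|alpha + beta|^2 = 1] and subtract [|alpha|^2 + |beta|^2 = 1]. *)
have cross : alpha * beta^* + beta * alpha^* = 0.
  have : (alpha + beta) * (alpha + beta)^* = 1 by rewrite ab1 rmorph1 mulr1.
  rewrite rmorphD mulrDl !mulrDr => E; apply: (addIr 1); rewrite add0r -[RHS]E -norm1.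
  by ring.
have Uji : U j i = beta by rewrite -[U]U_sym mxE.
have Ujj : U j j = alpha.
  have := orth i j; rewrite sumE Uji (negPf ij) mulr0n -cross => /addrI/(mulfI beta0).
  exact: (can_inj conjCK).
have Uj0 k : k != i -> k != j -> U j k = 0.
  move=> ki kj; have := orth j j.
  rewrite (bigD1 i) //= (bigD1 j) ?ji //= Uji Ujj eqxx.
  move=> E; have : \sum_(m | (m != i) && (m != j)) U j m * (U j m)^* = 0.
    apply: (addrI (alpha * alpha^* + beta * beta^*)); rewrite addr0 [RHS]norm1 -[RHS]E.
    by ring.
  move/eqP; rewrite psumr_eq0 => [/allP/(_ k)|m _]; last by rewrite mul_conjC_ge0.
  by rewrite mem_index_enum ki kj => /(_ isT) /=; rewrite mul_conjC_eq0 => /eqP.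
split=> //; apply/rowP => k; rewrite -rowE !mxE eqxx /=.
have [->|ki] := eqVneq k i; first by rewrite Uji (negPf ij) mulr0 mulr1 addr0.
have [->|kj] := eqVneq k j; first by rewrite Ujj mulr0 mulr1 add0r.
by rewrite Uj0 // !mulr0 addr0.
Qed.

Section Revival.
Variables (R : realType) (V : finType) (X : sgraph V) (a b : V) (tau : R).
Local Notation n := #|V|.
Local Notation U := (transition_mx X tau).

(** The values [s = 1] and [s = -1] give [e_a + e_b] and [e_a - e_b]; the ring varies because the
    same vector is read over [int], [rat] and [R[i]]. *)
Definition pair_vec (K : pzRingType) (s : K) : 'rV[K]_n :=
  delta_mx 0 (enum_rank a) + s *: delta_mx 0 (enum_rank b).

(** On the span of [e_a] and [e_b], [U] has diagonal entries [alpha] and off-diagonal entries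
    [beta]. Its eigenvalues there are [alpha + beta = 1] and [alpha - beta], distinct because
    [beta != 0]. *)
Lemma revival_pair : proper_LFR X a b tau ->
  pair_vec (1 : R[i]) *m U = pair_vec 1 /\
  exists2 zeta : R[i], zeta != 1 & pair_vec (-1) *m U = zeta *: pair_vec (-1).
Proof.
move=> [alpha [beta [[ab Ua] beta0]]].
have U1 : U *m const_mx 1 = const_mx 1 :> 'cV[R[i]]_n.
  apply: trmx_inj; rewrite trmx_mul trmx_const tr_transition.
  rewrite (@transition_eigen _ _ _ _ _ 0) ?mulr0 ?expi0 ?scale1r //.
  by rewrite laplacian_const scale0r.
have ij : enum_rank a != enum_rank b by rewrite (inj_eq enum_rank_inj).
have [ab1 Ui Uj] := unitary_revival (transition_unitary X tau) (tr_transition X tau)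
  U1 ij beta0 Ua.
split.
  by rewrite /pair_vec scale1r mulmxDl Ui Uj addrACA -!scalerDl [beta + _]addrC ab1 !scale1r.
exists (alpha - beta).
  apply: contra beta0 => /eqP E; have : beta *+ 2 = 0.
    by rewrite -(subrr 1) -{1}ab1 -E; ring.
  by move/eqP; rewrite mulrn_eq0.
rewrite /pair_vec mulmxDl -scalemxAl Ui Uj; apply/rowP => k; rewrite !mxE.
by ring.
Qed.
End Revival.

(** * Rational invariant subspaces *)

Section RationalBlock.
Variables (F K : fieldType) (f : {rmorphism F -> K}).

(* [B] spans the largest subspace of [F^n] on which [U] acts as [zeta]; it is
   [M]-stable because [M] commutes with [U]. *)
Lemma eigenspace_rational_base n (M : 'M[F]_n) (U : 'M[K]_n) zeta (w : 'rV[F]_n) :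
  map_mx f M *m U = U *m map_mx f M ->
  w != 0 -> map_mx f w *m U = zeta *: map_mx f w ->
  exists d (A : 'M[F]_d.+1) (B : 'M[F]_(d.+1, n)),
    [/\ row_free B, B *m M = A *m B, (w <= B)%MS &
        map_mx f B *m U = zeta *: map_mx f B].
Proof.
move=> MU w_neq0 wU.
pose fixed m (B : 'M[F]_(m, n)) := map_mx f B *m U = zeta *: map_mx f B.
have fixed_sub m1 m2 (B1 : 'M[F]_(m1, n)) (B2 : 'M[F]_(m2, n)) :
    (B1 <= B2)%MS -> fixed _ B2 -> fixed _ B1.
  by move=> /submxP[D ->] B2U; rewrite /fixed map_mxM -mulmxA B2U scalemxAr.
pose P r := asbool (exists2 B : 'M[F]_n, fixed n B & (\rank B = r)%N).
have P0 : exists r, P r.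
  by exists 0%N; apply/asboolP; exists 0; rewrite ?mxrank0 // /fixed map_mx0 mul0mx scaler0.
have P_le r : P r -> (r <= n)%N by move=> /asboolP[B _ <-]; exact: rank_leq_row.
case: (ex_maxnP P0 P_le) => r /asboolP[B BU Br] B_max.
(* By maximality of the rank, adjoining further rows on which [U] acts as [zeta] cannot enlarge the
   span of [B]. *)
have sub_fixed m (x : 'M[F]_(m, n)) : fixed _ x -> (x <= B)%MS.
  move=> xU; have BxU : fixed _ (B + x)%MS.
    apply: (@fixed_sub _ _ _ (col_mx B x)); first by rewrite addsmxE.
    by rewrite /fixed map_col_mx mul_col_mx BU xU scale_col_mx.
  have rank_le : (\rank (B + x)%MS <= \rank B)%N.
    by rewrite Br; apply: B_max; apply/asboolP; exists (B + x)%MS.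
  apply: submx_trans (addsmxSr B x) _.
  by rewrite -(geq_leqif (mxrank_leqif_sup (addsmxSl B x))).
have [r' [Bd [Bd_free BBd]]] : exists r' (Bd : 'M[F]_(r', n)), row_free Bd /\ (B :=: Bd)%MS.
  by exists (\rank B), (row_base B); split; [exact: row_base_free|exact/eqmx_sym/eq_row_base].
have BdU : fixed _ Bd by apply: fixed_sub BU; rewrite BBd.
have wBd : (w <= Bd)%MS by rewrite -BBd; exact: sub_fixed.
(* The base is nonempty because its span contains the nonzero [w]; this later provides at least one
   eigenvalue. *)
case: r' Bd Bd_free BBd BdU wBd => [|d] Bd Bd_free BBd BdU wBd.
  by move: w_neq0; have /submxP[D ->] := wBd; rewrite (flatmx0 Bd) mulmx0 eqxx.
have /submxP[A BdM] : (Bd *m M <= Bd)%MS.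
  by rewrite -BBd; apply: sub_fixed; rewrite /fixed map_mxM -mulmxA MU mulmxA BdU scalemxAl.
by exists d, A, Bd.
Qed.

Lemma root_base_eigenvector n (M : 'M[F]_n) d (A : 'M[F]_d) (B : 'M[F]_(d, n)) l :
  row_free B -> B *m M = A *m B -> root (map_poly f (char_poly A)) l ->
  exists y : 'rV[K]_d, y *m map_mx f B != 0 /\
    y *m map_mx f B *m map_mx f M = l *: (y *m map_mx f B).
Proof.
move=> B_free BM; rewrite map_char_poly -eigenvalue_root_char => /eigenvalueP[y yA y_neq0].
exists y; split; last by rewrite -mulmxA -map_mxM BM map_mxM mulmxA yA scalemxAl.
by rewrite mulmx_free_eq0 // row_free_map.
Qed.
End RationalBlock.

(** The product of the [M - x] applied to [w] one factor at a time, head of the list first, so that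
    groups of factors can be treated separately. *)
Definition mul_factors (F : pzRingType) n (M : 'M[F]_n) (w : 'rV[F]_n) (s : seq F) :=
  foldl (fun y x => y *m (M - x%:M)) w s.

(** Writing [w = u *m B] moves every factor across [B] to [A], where Cayley-Hamilton applies. *)
Lemma mul_factors_char_poly (F : fieldType) n (M : 'M[F]_n) (w : 'rV[F]_n)
    d (A : 'M[F]_d.+1) (B : 'M[F]_(d.+1, n)) (s : seq F) :
  B *m M = A *m B -> (w <= B)%MS -> char_poly A = \prod_(x <- s) ('X - x%:P) ->
  mul_factors M w s = 0.
Proof.
move=> BM /submxP[u ->] A_s.
have factorsE t v : mul_factors M (v *m B) t = v *m (\prod_(x <- t) (A - x%:M)) *m B.
  elim: t v => [|x t IHt] v; first by rewrite big_nil mulmx1.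
  have step : v *m B *m (M - x%:M) = v *m (A - x%:M) *m B.
    by rewrite -!mulmxA mulmxBr mulmxBl BM mul_mx_scalar mul_scalar_mx.
  rewrite /mul_factors /= step -/(mul_factors _ _ _) IHt big_cons.
  by congr (_ *m _); rewrite -mulmxA.
rewrite factorsE -[\prod_(x <- s) _](_ : horner_mx A (char_poly A) = _).
  by rewrite Cayley_Hamilton mulmx0 mul0mx.
rewrite A_s rmorph_prod; apply: eq_bigr => x _.
by rewrite rmorphB /= horner_mx_X horner_mx_C.
Qed.

(** A symmetric matrix has no nilpotent part, so repeated equal factors collapse to a single one. *)
Lemma symm_mul_factors_ker (F : realDomainType) n (M : 'M[F]_n) (w : 'rV[F]_n) c s :
  M^T = M -> all (pred1 c) s -> mul_factors M w s = 0 -> w *m (M - c%:M) = 0.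
Proof.
move=> M_sym; have Mc_sym : (M - c%:M)^T = M - c%:M by rewrite linearB /= M_sym tr_scalar_mx.
elim: s w => [|x s IHs] w /=; first by move=> _ ->; rewrite mul0mx.
by move=> /andP[/eqP -> s_c] /(IHs _ s_c); exact: symm_sqr_ker.
Qed.

(** The characteristic polynomial is monic and integral, and a rational algebraic integer is an
    integer. *)
Lemma rat_eigenvalue_int n (M : 'M[int]_n) (q : rat) :
  root (char_poly (map_mx intr M)) q -> q \is a Num.int.
Proof.
move=> Mq; have : (ratr q : algC) \is a Num.int.
  apply: Cint_rat_Aint; first exact: Crat_rat.
  apply: (@root_monic_Aint (map_poly ratr (char_poly (map_mx intr M)))).
  - by rewrite fmorph_root.
  - by rewrite map_monic char_poly_monic.
  rewrite -map_char_poly -map_poly_comp; apply/polyOverP => i.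
  by rewrite coef_map /= ratr_int.
move=> /intrP[m] /eqP; rewrite -(ratr_int algC) (inj_eq (fmorph_inj _)) => /eqP ->.
exact: intr_int.
Qed.

Section RationalSpectrum.
Variables (R : realType) (V : finType) (X : sgraph V) (tau : R).
Local Notation n := #|V|.
Local Notation U := (transition_mx X tau).

(** [s] lists, with multiplicity, the eigenvalues of the Laplacian on a rational stable space
    containing [w] where [U] acts as [zeta]. The last clause is conditional because rationality of
    each eigenvalue is derived later from that of the sum; its free order of factors lets zero and
    nonzero eigenvalues be separated. *)
Lemma rational_spectrum (w : 'rV[rat]_n) (zeta : R[i]) :
  w != 0 -> map_mx ratr w *m U = zeta *: map_mx ratr w ->
  exists s : seq R,
  [/\ s != [::],
      forall r, r \in s -> 0 <= r <= n%:R /\ expi (tau * r) = zeta,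
      exists q : rat, \sum_(r <- s) r = ratr q &
      (forall r, r \in s -> exists q : rat, r = ratr q) ->
      exists2 k : seq int, s = [seq x%:~R | x <- k] &
        forall k', perm_eq k' k ->
          mul_factors (laplacian_mx rat X) w [seq x%:~R | x <- k'] = 0].
Proof.
move=> w_neq0 wU.
have [|d [A [B [B_free BL wB BU]]]] := eigenspace_rational_base
  (f := ratr) (M := laplacian_mx rat X) _ w_neq0 wU.
  by rewrite map_laplacian transition_comm.
pose toR : {rmorphism rat -> R} := ratr; pose toC : {rmorphism rat -> R[i]} := ratr.
have [rs charA] := closed_field_poly_normal (map_poly toC (char_poly A)).
have charA_monic : map_poly toC (char_poly A) \is monic by rewrite map_monic char_poly_monic.
rewrite (monicP charA_monic) scale1r in charA.
have rootP z : z \in rs -> [/\ 0 <= complex.Re z <= n%:R, expi (tau * complex.Re z) = zeta &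
    z = (complex.Re z)%:C%C].
  move=> z_rs.
  have z_root : root (map_poly toC (char_poly A)) z by rewrite charA root_prod_XsubC.
  have [y [y_neq0 yL]] := root_base_eigenvector B_free BL z_root.
  rewrite map_laplacian in yL.
  have z_ge0 := laplacian_eigenvalue_ge0 yL y_neq0.
  have z_le := laplacian_eigenvalue_le yL y_neq0.
  have zE : z = (complex.Re z)%:C%C by rewrite RRe_real // ger0_real.
  rewrite zE in z_ge0 z_le; rewrite ler0c in z_ge0.
  rewrite -(rmorph_nat (real_complex R)) lecR in z_le.
  split=> //; first by rewrite z_ge0.
  have yU : y *m map_mx toC B *m U = expi (tau * complex.Re z) *: (y *m map_mx toC B).
    by apply: transition_eigen; rewrite -zE.
  move: yU; rewrite -mulmxA BU -scalemxAr => /eqP; rewrite -subr_eq0 -scalerBl scaler_eq0.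
  by rewrite (negPf y_neq0) orbF subr_eq0 => /eqP.
pose s := map (@complex.Re R) rs.
have rsE : rs = map (real_complex R) s.
  by rewrite -map_comp -[LHS]map_id; apply/eq_in_map => z /rootP[_ _].
have charAR : map_poly toR (char_poly A) = \prod_(r <- s) ('X - r%:P).
  apply: (@map_poly_inj _ _ (real_complex R)); rewrite rmorph_prod -map_poly_comp.
  rewrite (eq_map_poly (g := toC)) => [|x]; last by rewrite /= fmorph_rat.
  by rewrite charA rsE big_map; apply: eq_bigr => r _; rewrite rmorphB /= map_polyX map_polyC.
have size_s : size s = d.+1.
  have := size_char_poly A; rewrite -(size_map_poly toR) charAR size_prod_XsubC.
  by case.
exists s; split.
- by rewrite -size_eq0 size_s.
- by move=> _ /mapP[z /rootP[? ? _] ->].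
(* The eigenvalue sum is the trace of a rational matrix, read off the second coefficient of the
   characteristic polynomial. *)
- exists (\tr A); have := char_poly_trace A (ltn0Sn d).
  have := @coefPn_prod_XsubC _ s; rewrite size_s => /(_ isT) coef_s.
  by move=> /(congr1 toR); rewrite rmorphN -coef_map charAR coef_s => /oppr_inj.
move=> s_rat.
have s_int r : r \in s -> exists k : int, r = k%:~R.
  move=> rs_r; have [q rq] := s_rat r rs_r.
  have q_root : root (char_poly A) q.
    by rewrite -(fmorph_root toR) charAR root_prod_XsubC /= -rq.
  have : root (map_poly idfun (char_poly A)) q by rewrite map_poly_id.
  move=> /(root_base_eigenvector B_free BL)[y [y_neq0]].
  rewrite !map_mx_id // in y_neq0 *; move=> yL.
  have /rat_eigenvalue_int/intrP[k qk] : root (char_poly (map_mx intr (laplacian_mx int X))) q.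
    by rewrite map_laplacian -eigenvalue_root_char; apply/eigenvalueP; exists (y *m B).
  by exists k; rewrite rq qk ratr_int.
have [k sk] : exists k : seq int, s = [seq x%:~R | x <- k].
  elim: (s) s_int => [|r t IHt] t_int; first by exists [::].
  have [m ->] := t_int r (mem_head _ _).
  have [k ->] := IHt (fun x xt => t_int x (mem_behead (s := r :: t) xt)).
  by exists (m :: k).
exists k => // k' k'k; apply: (mul_factors_char_poly BL wB).
apply: (map_poly_inj toR); rewrite charAR sk rmorph_prod !big_map -(perm_big _ k'k) /=.
by apply: eq_bigr => x _; rewrite rmorphB /= map_polyX map_polyC /= ratr_int.
Qed.
End RationalSpectrum.

(** * Integrality and double cones *)

Lemma double_coneP (V : finType) (X : sgraph V) (a b : V) :
  a != b -> ~~ X a b -> (forall x, x != a -> x != b -> X x a && X x b) ->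
  double_cone X.
Proof.
move=> ab nab dom; pose W := {x : V | (x != a) && (x != b)}.
pose Y_adj : rel W := fun x y => X (val x) (val y).
have Y_sym : symmetric Y_adj by move=> x y; exact: adj_sym.
have Y_irr : irreflexive Y_adj by move=> x; exact: adj_irr.
exists W, (SGraph Y_sym Y_irr).
(* [insub] succeeds exactly outside the pair; the conical vertices [a] and [b] go to the two
   elements of ['I_2]. *)
pose f (x : V) : 'I_2 + W :=
  if insub x is Some y then inr y else inl (if x == a then ord0 else ord_max).
pose g (u : 'I_2 + W) : V :=
  match u with inl i => if i == ord0 then a else b | inr y => val y end.
have ba : (b == a) = false by rewrite eq_sym (negPf ab).
have fa : f a = inl ord0 by rewrite /f insubN ?eqxx.
have fb : f b = inl ord_max by rewrite /f insubN ?eqxx ?andbF // ba.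
have f_val (y : W) : f (val y) = inr y by rewrite /f valK.
have fP x : [\/ x = a, x = b | exists y : W, x = val y].
  have [->|xa] := eqVneq x a; first by constructor 1.
  have [->|xb] := eqVneq x b; first by constructor 2.
  have x_ab : (x != a) && (x != b) by rewrite xa.
  by constructor 3; exists (Sub x x_ab); rewrite SubK.
have X_val (y : W) : X (val y) a /\ X (val y) b.
  by have /andP[ya yb] := valP y; apply/andP; exact: dom.
exists f; split.
  exists g => [x|[i|y]]; last exact: f_val.
    by have [->|->|[y ->]] := fP x; rewrite ?fa ?fb ?f_val.
  rewrite /=; case: eqP => [->|/eqP i0]; rewrite ?fa ?fb //; congr inl.
  by apply/val_inj; case: i i0 => [[|[|]]].
have nX : ~~ X b a by rewrite adj_sym.
move=> x y; have [->|->|[x' ->]] := fP x; have [->|->|[y' ->]] := fP y;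
  rewrite ?fa ?fb ?f_val //= /compl_adj /complete_adj ?adj_irr ?(negPf nab) ?(negPf nX) //.
- by case: (X_val y') => + _; rewrite adj_sym => ->.
- by case: (X_val y') => _; rewrite adj_sym => ->.
- by case: (X_val x') => ->.
- by case: (X_val x') => _ ->.
Qed.

Section MulFactors.
Variables (F : comPzRingType) (n : nat) (M : 'M[F]_n).

Lemma mul_factors_cat (y : 'rV[F]_n) s t :
  mul_factors M y (s ++ t) = mul_factors M (mul_factors M y s) t.
Proof. exact: foldl_cat. Qed.

Lemma mul_factors_mul (y : 'rV[F]_n) c s :
  mul_factors M (y *m (M - c%:M)) s = mul_factors M y s *m (M - c%:M).
Proof.
elim: s y => [|x s IHs] y //; rewrite /mul_factors /= -!/(mul_factors _ _ _) -IHs.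
congr mul_factors; rewrite -!mulmxA; congr (_ *m _); apply: comm_mx_sym.
have comm_c A : comm_mx A M -> comm_mx A (M - c%:M).
  by move=> AM; apply: comm_mxB => //; exact: comm_mx_scalar.
by apply/comm_c/comm_mx_sym/comm_mxB; [exact: comm_mx_refl|exact: comm_mx_scalar].
Qed.
End MulFactors.

(** The Laplacian kills the all-ones column, so each factor multiplies the entry sum by [- x]. *)
Lemma sum_mul_factors (V : finType) (X : sgraph V) (K : comPzRingType) (y : 'rV[K]_#|V|) s :
  \sum_j (mul_factors (laplacian_mx K X) y s) 0 j = (\prod_(x <- s) - x) * \sum_j y 0 j.
Proof.
elim: s y => [|x s IHs] y; first by rewrite big_nil mul1r.
rewrite /mul_factors /= -/(mul_factors _ _ _) IHs big_cons [- x * _]mulrC -mulrA.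
congr (_ * _); have sumE (z : 'rV[K]_#|V|) : \sum_j z 0 j = (z *m (const_mx 1 : 'cV_#|V|)) 0 0.
  by rewrite mxE; apply: eq_bigr => j _; rewrite mxE mulr1.
rewrite !sumE -mulmxA mulmxBl laplacian_mul_const sub0r mul_scalar_mx mulmxN.
by rewrite -scalemxAr !mxE mulNr.
Qed.

Lemma mul_factors_int (V : finType) (X : sgraph V) (y : 'rV[int]_#|V|) (k : seq int) :
  mul_factors (laplacian_mx rat X) (map_mx intr y) [seq x%:~R | x <- k] =
  map_mx intr (mul_factors (laplacian_mx int X) y k).
Proof.
elim: k y => [|x k IHk] y //; rewrite /mul_factors /= -!/(mul_factors _ _ _) -IHk.
by congr mul_factors; rewrite map_mxM map_mxB map_laplacian map_scalar_mx.
Qed.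

Lemma Euclid_prodz (p : nat) (k : seq int) :
  prime p -> (p %| \prod_(x <- k) x)%Z -> exists2 x, x \in k & (p %| x)%Z.
Proof.
move=> p_prime; elim: k => [|x k IHk].
  by rewrite big_nil dvdzE /= dvdn1 => /eqP p1; rewrite p1 in p_prime.
rewrite big_cons dvdzE abszM Euclid_dvdM // => /orP[px|pk].
  by exists x; rewrite ?mem_head // dvdzE.
by have [|y yk py] := IHk; [rewrite dvdzE|exists y; rewrite // in_cons yk orbT].
Qed.

Section Periods.
Variables (R : realType) (tau : R).

(* The generator of the group of periods is [2 pi / tau]; a rational nonzero sum of
   periods makes it rational. *)
Lemma rational_period (s : seq R) (q : rat) :
  tau != 0 -> (forall r, r \in s -> expi (tau * r) = 1) ->
  \sum_(r <- s) r = ratr q -> q != 0 ->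
  exists c : rat, forall r, expi (tau * r) = 1 -> exists m : int, r = ratr (c * m%:~R).
Proof.
move=> tau0 s1 sumq q0; pose c : R := pi *+ 2 / tau.
have periodP r : expi (tau * r) = 1 -> exists m : int, r = c * m%:~R.
  move=> /expi_eq1[m rm]; exists m; apply: (mulfI tau0).
  by rewrite rm mulrA mulrCA mulfV // mulr1.
have [m sm] : exists m : int, \sum_(r <- s) r = c * m%:~R.
  elim: (s) s1 => [|r t IHt] t1; first by exists 0; rewrite big_nil mulr0.
  have [m1 ->] := periodP r (t1 r (mem_head _ _)).
  have [m2 tm] := IHt (fun x xt => t1 x (mem_behead (s := r :: t) xt)).
  by exists (m1 + m2); rewrite big_cons tm -mulrDr intrD.
have m0 : m%:~R != 0 :> R.
  apply: contra q0 => /eqP m0; rewrite -(fmorph_eq0 (ratr : {rmorphism rat -> R})) /=.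
  by rewrite -sumq sm m0 mulr0.
have cE : c = ratr (q / m%:~R).
  by rewrite fmorph_div /= ratr_int -sumq sm mulfK.
exists (q / m%:~R) => r /periodP[l ->]; exists l.
by rewrite cE [in RHS]rmorphM /= ratr_int.
Qed.
End Periods.

Section PairVector.
Variables (V : finType) (a b : V).

Lemma pair_vecE (K : pzRingType) (s : K) j :
  pair_vec a b s 0 j = (j == enum_rank a)%:R + s * (j == enum_rank b)%:R.
Proof. by rewrite !mxE. Qed.

Lemma map_pair_vec (K K' : pzRingType) (f : {rmorphism K -> K'}) (s : K) :
  map_mx f (pair_vec a b s) = pair_vec a b (f s).
Proof. by apply/rowP => j; rewrite mxE !pair_vecE rmorphD rmorphM !rmorph_nat. Qed.

Lemma pair_vec_neq0 (K : nzRingType) (s : K) : a != b -> pair_vec a b s != 0.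
Proof.
move=> ab; apply/eqP => /rowP/(_ (enum_rank a)); rewrite pair_vecE mxE eqxx.
by rewrite (inj_eq enum_rank_inj) (negPf ab) mulr0 addr0 => /eqP; rewrite oner_eq0.
Qed.

Lemma sum_pair_vec (K : pzRingType) (s : K) : \sum_j pair_vec a b s 0 j = 1 + s.
Proof.
under eq_bigr do rewrite pair_vecE.
have delta i : \sum_j (j == i)%:R = 1 :> K.
  by rewrite (bigD1 i) //= eqxx big1 ?addr0 // => j /negPf ->.
by rewrite big_split -mulr_sumr !delta mulr1.
Qed.

Lemma pair_vec_out (K : pzRingType) (s : K) x :
  x != a -> x != b -> pair_vec a b s 0 (enum_rank x) = 0.
Proof.
move=> xa xb; rewrite pair_vecE !(inj_eq enum_rank_inj) (negPf xa) (negPf xb).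
by rewrite mulr0 addr0.
Qed.
End PairVector.

(** * Spectra of the sum and difference vectors of the revival pair *)

Section PrimeRevival.
Variables (R : realType) (V : finType) (X : sgraph V) (a b : V) (tau : R).
Local Notation n := #|V|.
Local Notation L := (laplacian_mx rat X).
Local Notation U := (transition_mx X tau).
Hypotheses (X_conn : graph_connected X) (ab : a != b).

(** The spectrum of [e_a - e_b] with a distinguished member [r0], to which the others are compared
    modulo periods. *)
Lemma difference_spectrum (zeta : R[i]) :
  pair_vec a b (-1) *m U = zeta *: pair_vec a b (-1) ->
  exists r0 (s : seq R),
  [/\ forall r, r \in r0 :: s -> expi (tau * r) = zeta,
      exists q : rat, \sum_(r <- r0 :: s) r = ratr q &
      (forall r, r \in r0 :: s -> exists q : rat, r = ratr q) ->
      exists m : int, r0 = m%:~R].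
Proof.
move=> vU.
have v_eigen : map_mx ratr (pair_vec a b (-1 : rat)) *m U =
    zeta *: map_mx ratr (pair_vec a b (-1 : rat)).
  by rewrite map_pair_vec rmorphN1.
have [[|r0 s] [// _ s_zeta sumq s_int]] := rational_spectrum (pair_vec_neq0 _ ab) v_eigen.
exists r0, s; split=> // [r /s_zeta[]//|/s_int[[//|m k] [-> _] _]].
by exists m.
Qed.

Lemma revival_time_neq0 (zeta : R[i]) :
  pair_vec a b (-1) *m U = zeta *: pair_vec a b (-1) -> zeta != 1 -> tau != 0.
Proof.
move=> /difference_spectrum[r0 [s [s_zeta _ _]]]; apply: contra => /eqP tau0.
by rewrite -(s_zeta r0) ?mem_head // tau0 mul0r expi0.
Qed.

(* The eigenvalues of [L] on the rational [zeta]-eigenspace of [U] are congruent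
   modulo [c], so their rational sum makes them rational, hence integral; but
   [expi tau = 1] forces [zeta = 1] as soon as one of them is an integer. *)
Lemma difference_period (zeta : R[i]) (c : rat) :
  pair_vec a b (-1) *m U = zeta *: pair_vec a b (-1) -> zeta != 1 ->
  (forall r, expi (tau * r) = 1 -> exists m : int, r = ratr (c * m%:~R)) ->
  expi tau != 1.
Proof.
move=> vU zeta1 periodP; apply: contra zeta1 => /eqP tau1.
have [r0 [s [s_zeta [q sumq] s_int]]] := difference_spectrum vU.
have diff r : r \in r0 :: s -> exists m : int, r - r0 = ratr (c * m%:~R).
  move=> /s_zeta r_zeta; apply: periodP.
  apply: (mulIf (expi_neq0 (tau * r0))); rewrite -expiD -mulrDr subrK mul1r r_zeta.
  by rewrite s_zeta ?mem_head.
have [m summ] : exists m : int, \sum_(r <- r0 :: s) (r - r0) = ratr (c * m%:~R).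
  elim: (r0 :: s) diff => [|r t IHt] t_diff.
    by exists 0; rewrite big_nil mulr0 rmorph0.
  have [m1 rm1] := t_diff r (mem_head _ _).
  have [m2 tm2] := IHt (fun x xt => t_diff x (mem_behead (s := r :: t) xt)).
  by exists (m1 + m2); rewrite big_cons rm1 tm2 -rmorphD /= intrD mulrDr.
pose d := size (r0 :: s).
have sum_r0 : \sum_(r <- r0 :: s) (r - r0) = ratr q - r0 *+ d.
  by rewrite sumrB sumq big_const_seq count_predT iter_addr_0.
(* Solve for [r0] in the sum of the [d] differences; [d] is positive as the list has a head. *)
have r0E : r0 = ratr ((q - c * m%:~R) / d%:R).
  rewrite fmorph_div rmorphB /= -summ sum_r0 opprB addrC subrK ratr_nat.
  by rewrite -[r0 *+ d]mulr_natr mulfK // pnatr_eq0.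
have [|x r0x] := s_int.
  move=> r /diff[m1 rm1]; exists (c * m1%:~R + (q - c * m%:~R) / d%:R).
  by rewrite rmorphD /= -rm1 -r0E subrK.
by rewrite -(s_zeta r0) ?mem_head // r0x expiMz.
Qed.

(* The nonnegative eigenvalues of [L] on the rational vectors fixed by [U] are not all
   zero, since otherwise [e_a + e_b] would be constant; so they have a nonzero sum. *)
Lemma sum_spectrum :
  tau != 0 -> (2 < n)%N -> pair_vec a b 1 *m U = pair_vec a b 1 ->
  exists (c : rat) (k : seq int),
  [/\ forall r, expi (tau * r) = 1 -> exists m : int, r = ratr (c * m%:~R),
      forall x, x \in k -> 0 <= x <= n%:Z /\ expi (tau * x%:~R) = 1 &
      forall k', perm_eq k' k ->
        mul_factors L (pair_vec a b 1) [seq x%:~R | x <- k'] = 0].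
Proof.
move=> tau0 n_gt2 wU.
have w_eigen : map_mx ratr (pair_vec a b (1 : rat)) *m U =
    1 *: map_mx ratr (pair_vec a b (1 : rat)).
  by rewrite map_pair_vec rmorph1 scale1r.
have [s [s0 s_zeta [q sumq] s_int]] := rational_spectrum (pair_vec_neq0 _ ab) w_eigen.
have [s_zero|] := boolP (all (pred1 0) s).
  have [|k sk k_ann] := s_int.
    by move=> r /(allP s_zero)/eqP ->; exists 0; rewrite rmorph0.
  have k_zero : all (pred1 0) [seq x%:~R : rat | x <- k].
    rewrite sk all_map in s_zero; rewrite all_map.
    by apply: sub_all s_zero => x /=; rewrite !intr_eq0.
  have := symm_mul_factors_ker (tr_laplacian X rat) k_zero (k_ann k (perm_refl k)).
  rewrite raddf0 subr0 => /(laplacian_ker X_conn) w_const.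
  (* A third vertex refutes constancy: [e_a + e_b] is 1 at [a] and 0 at [x]. *)
  have [x /andP[xa xb]] : exists x, (x != a) && (x != b).
    apply/existsP; apply: contraLR n_gt2; rewrite negb_exists -leqNgt => /forallP V_ab.
    rewrite -cardsT; apply: (leq_trans (n := #|[set a; b]%SET|)).
      by apply/subset_leq_card/fintype.subsetP => y _; have := V_ab y; rewrite !inE negb_and !negbK.
    by rewrite cards2 ab.
  have := w_const (enum_rank a) (enum_rank x); rewrite (pair_vec_out _ xa xb) pair_vecE eqxx.
  rewrite (inj_eq enum_rank_inj) (negPf ab) mulr0 addr0 => /eqP.
  by rewrite oner_eq0.
rewrite -has_predC => /hasP[r rs /= r0].
have q0 : q != 0.
  apply: contra r0 => /eqP q0; move: sumq; rewrite q0 rmorph0 => /eqP.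
  rewrite big_seq psumr_eq0 => [/allP/(_ r rs)|x /s_zeta[/andP[]]//].
  by rewrite rs.
have [c periodP] := rational_period tau0 (fun r rs => (s_zeta r rs).2) sumq q0.
have [|k sk k_ann] := s_int.
  by move=> x /s_zeta[_ /periodP[m ->]]; exists (c * m%:~R).
exists c, k; split=> // x xk; have /s_zeta[] : (x%:~R : R) \in s by rewrite sk map_f.
by rewrite ler0z -[n%:R]/(n%:Z%:~R) ler_int.
Qed.

(* Evaluating the annihilating polynomial of [e_a + e_b], stripped of its zero roots,
   gives an integer multiple [z] of the all-ones vector; comparing entry sums,
   [n z = 2 \prod (- x)] over the nonzero eigenvalues [x]. *)
Lemma order_in_spectrum (k : seq int) :
  prime n -> odd n -> (forall x, x \in k -> 0 <= x <= n%:Z) ->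
  (forall k', perm_eq k' k ->
    mul_factors L (pair_vec a b 1) [seq x%:~R | x <- k'] = 0) ->
  n%:Z \in k.
Proof.
move=> n_prime n_odd k_le k_ann.
pose k1 := [seq x <- k | x != 0]; pose k0 := [seq x <- k | ~~ (x != 0)].
pose zZ := mul_factors (laplacian_mx int X) (pair_vec a b 1) k1.
have wZ : pair_vec a b 1 = map_mx intr (pair_vec a b (1 : int)) :> 'rV[rat]_n.
  by rewrite map_pair_vec.
have zL : map_mx intr zZ *m L = 0.
  rewrite /zZ -mul_factors_int -wZ.
  have k0_zero : all (pred1 0) [seq x%:~R : rat | x <- k0].
    rewrite all_map; apply/allP => x; rewrite mem_filter negbK => /andP[/eqP -> _] /=.
    by rewrite eqxx.
  have /(symm_mul_factors_ker (tr_laplacian X rat) k0_zero) :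
      mul_factors L (mul_factors L (pair_vec a b 1) [seq x%:~R | x <- k1])
        [seq x%:~R | x <- k0] = 0.
    by rewrite -mul_factors_cat -map_cat k_ann // perm_filterC.
  by rewrite raddf0 subr0.
have z_const i j : zZ 0 i = zZ 0 j.
  by have := laplacian_ker X_conn zL i j; rewrite !mxE => /intr_inj.
have := sum_mul_factors X (pair_vec a b (1 : int)) k1; rewrite sum_pair_vec -/zZ.
rewrite (eq_bigr (fun=> zZ 0 (enum_rank a))) => [|j _]; last exact: z_const.
rewrite sumr_const card_ord -mulr_natr => zn.
have : (n %| \prod_(x <- (1 + 1) :: map -%R k1) x)%Z.
  by rewrite big_cons big_map mulrC -zn natz dvdz_mull // dvdzz.
(* The head [1 + 1] is the entry sum of [e_a + e_b]; oddness of [n] excludes it as the multiple of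
   [n]. *)
move=> /(Euclid_prodz n_prime)[x]; rewrite in_cons => /orP[/eqP ->|/mapP[y + ->]].
  by rewrite dvdzE /= (dvdn_prime2 n_prime) // => /eqP n2; rewrite n2 in n_odd.
rewrite mem_filter => /andP[y0 yk]; rewrite dvdzE abszN => ny.
have /andP[y_ge0 y_le] := k_le y yk; case: y y_ge0 y0 y_le yk ny => // y _ y0 y_le yk ny.
have n_y : (n <= y)%N by rewrite dvdn_leq // lt0n.
by rewrite (_ : n = y) //; apply/eqP; rewrite eqn_leq n_y -lez_nat.
Qed.

(** With only 0 and [n] as roots, symmetry gives [w (L - n) L = 0], so [w (L - n)] is constant. Its
    value and the neighbour count at a vertex outside the pair then force both adjacencies. *)
Lemma dominating_pair (k : seq int) :
  n%:Z \in k -> (forall x, x \in k -> x = 0 \/ x = n%:Z) ->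
  (forall k', perm_eq k' k ->
    mul_factors L (pair_vec a b 1) [seq x%:~R | x <- k'] = 0) ->
  forall x, x != a -> x != b -> X x a && X x b.
Proof.
move=> nk k0n k_ann.
pose k1 := [seq x <- k | x != 0]; pose k0 := [seq x <- k | ~~ (x != 0)].
pose w : 'rV[rat]_n := pair_vec a b 1.
have k0_zero : all (pred1 0) [seq x%:~R : rat | x <- k0].
  rewrite all_map; apply/allP => x; rewrite mem_filter negbK => /andP[/eqP -> _] /=.
  by rewrite eqxx.
have k1_n : all (pred1 n%:R) [seq x%:~R : rat | x <- k1].
  rewrite all_map; apply/allP => x; rewrite mem_filter => /andP[x0 /k0n[x0'|->]] /=.
    by rewrite x0' in x0.
  by rewrite eqxx.
(* Collapse the factors [L - n], move the surviving one to the front, then collapse the factors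
   [L]. *)
have wLn : w *m (L - n%:R%:M) *m L = 0.
  have /(symm_mul_factors_ker (tr_laplacian X rat) k1_n) :
      mul_factors L (mul_factors L w [seq x%:~R | x <- k0]) [seq x%:~R | x <- k1] = 0.
    by rewrite -mul_factors_cat -map_cat k_ann // perm_catC perm_filterC.
  rewrite -mul_factors_mul => /(symm_mul_factors_ker (tr_laplacian X rat) k0_zero).
  by rewrite raddf0 subr0.
have w_const := laplacian_ker X_conn wLn.
move=> x xa xb; set i := enum_rank x.
have n0 : n%:R != 0 :> rat by rewrite pnatr_eq0 -lt0n; apply/card_gt0P; exists a.
(* The [n] equal entries sum to [- n] times the entry sum 2 of [w]. *)
have wi : (w *m (L - n%:R%:M)) 0 i = - 2.
  apply: (mulIf n0); transitivity (\sum_j (w *m (L - n%:R%:M)) 0 j).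
    rewrite (eq_bigr (fun=> (w *m (L - n%:R%:M)) 0 i)) => [|j _]; last exact: w_const.
    by rewrite sumr_const card_ord mulr_natr.
  have := sum_mul_factors X w [:: n%:R]; rewrite big_seq1 sum_pair_vec => ->.
  by rewrite mulrC mulNr mulrN.
have w_i : w 0 i = 0 by exact: pair_vec_out.
have wL : (w *m L) 0 i = - 2.
  have -> : w *m L = w *m (L - n%:R%:M) + n%:R *: w.
    by rewrite [w *m (L - _)]mulmxBr mul_mx_scalar subrK.
  by rewrite mxE wi mxE w_i mulr0 addr0.
have ba : (b == a) = false by rewrite eq_sym (negPf ab).
(* Only the terms of [a] and [b] survive, each contributing -1 exactly when adjacent to [x];
   reaching -2 takes both. *)
move: wL; rewrite mul_laplacian (bigD1 (enum_rank a)) //= (bigD1 (enum_rank b)) /=; last first.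
  by rewrite (inj_eq enum_rank_inj) ba.
rewrite big1 => [|j /andP[ja jb]]; last first.
  have w_j : w 0 j = 0 by rewrite /w pair_vecE (negPf ja) (negPf jb) mulr0 addr0.
  by rewrite w_i w_j subrr mulr0.
rewrite w_i /w !pair_vecE !enum_rankK !eqxx !(inj_eq enum_rank_inj) ba (negPf ab).
by rewrite !(adj_sym X x); case: (X a x); case: (X b x).
Qed.

(** If [a] and [b] were adjacent, both would be isolated in the complement, whose Laplacian would
    kill [e_a - e_b]. This vector would then have eigenvalue [n], and [expi (tau * n) = 1] would
    give [zeta = 1]. *)
Lemma nonadjacent_pair (zeta : R[i]) :
  pair_vec a b (-1) *m U = zeta *: pair_vec a b (-1) -> zeta != 1 ->
  expi (tau * n%:R) = 1 -> (forall x, x != a -> x != b -> X x a && X x b) ->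
  ~~ X a b.
Proof.
move=> vU zeta1 tau_n dom; apply: contra zeta1 => Xab.
have Xba : X b a by rewrite adj_sym.
pose v : 'rV[R[i]]_n := pair_vec a b (-1).
have vL : v *m laplacian_mx R[i] X = (n%:R : R)%:C%C *: v.
  apply/rowP => j; have := mul_laplacian_compl X v j.
  rewrite sum_pair_vec subrr subr0 [v *m laplacian_mx R[i] (compl_graph X)](_ : _ = 0).
    by rewrite [X in _ + X]mxE addr0 => ->; rewrite [RHS]mxE rmorph_nat mulr_natl.
  (* A complement edge avoids [a] and [b], so [v] vanishes at both of its ends. *)
  apply/rowP => i; rewrite mul_laplacian [RHS]mxE big1 // => l _ /=.
  rewrite /compl_adj; case: eqVneq => [_|li] /=; first by rewrite mul0r.
  have v_out m : enum_val m != a -> enum_val m != b -> v 0 m = 0.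
    by move=> ma mb; rewrite -[m]enum_valK; exact: pair_vec_out.
  move: (v_out l) (v_out i) li; move: (enum_val l) (enum_val i) => y z vl vi yz.
  have [ya|ya] := eqVneq y a.
    have [zb|zb] := eqVneq z b; first by rewrite ya zb Xab mul0r.
    have za : z != a by rewrite -ya eq_sym.
    by have /andP[] := dom z za zb; rewrite ya adj_sym => ->; rewrite mul0r.
  have [yb|yb] := eqVneq y b.
    have [za|za] := eqVneq z a; first by rewrite yb za Xba mul0r.
    have zb : z != b by rewrite -yb eq_sym.
    by have /andP[_] := dom z za zb; rewrite yb adj_sym => ->; rewrite mul0r.
  have /andP[Xya Xyb] := dom y ya yb.
  have [->|za] := eqVneq z a; first by rewrite Xya mul0r.
  have [->|zb] := eqVneq z b; first by rewrite Xyb mul0r.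
  by rewrite vl // vi // subrr mulr0.
have := transition_eigen tau vL; rewrite tau_n scale1r vU => /eqP.
rewrite -[X in _ == X]scale1r -subr_eq0 -scalerBl scaler_eq0 subr_eq0.
by rewrite (negPf (pair_vec_neq0 _ ab)) orbF.
Qed.
End PrimeRevival.

Theorem theorem11p9 (R : realType) (p : nat) (V : finType) (X : sgraph V)
    (p_prime : prime p) (p_odd : odd p) (cardV : #|V| = p)
    (X_connected : graph_connected X)
    (X_LFR : exists (a b : V) (tau : R), proper_LFR X a b tau) :
  double_cone X.
Proof.
subst p; have [a [b [tau X_rev]]] := X_LFR.
have ab : a != b by case: X_rev => alpha [beta [[]]].
have [wU [zeta zeta1 vU]] := revival_pair X_rev.
have tau0 := revival_time_neq0 ab vU zeta1.
have n_gt2 : (2 < #|V|)%N by rewrite odd_prime_gt2.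
have [c [k [periodP k_eig k_ann]]] := sum_spectrum X_connected ab tau0 n_gt2 wU.
have nk : #|V|%:Z \in k.
  by apply: (order_in_spectrum (X := X) (a := a) (b := b)) => // x /k_eig[].
have k0n x : x \in k -> x = 0 \/ x = #|V|.
  move=> xk; have [/andP[x_ge0 x_le] tau_x] := k_eig x xk.
  case: x x_ge0 x_le xk tau_x => // x _ x_le xk tau_x.
  have [->|x0] := eqVneq x 0; [by left|right].
  apply/eqP; apply: contraNT (difference_period ab vU zeta1 periodP) => xn.
  (* Bezout coefficients for [0 < x < n] write [tau] as an integral combination of [tau * x] and
     [tau * n], at both of which [expi] is 1. *)
  have /coprimezP[[u v] /= uv] : coprimez x #|V|.
    rewrite coprimez_sym coprimezE /= prime_coprime // gtnNdvd ?lt0n //.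
    by rewrite ltn_neqAle xn.
  have [_ tau_n] := k_eig _ nk.
  have -> : tau = tau * x%:~R * u%:~R + tau * #|V|%:~R * v%:~R.
    by rewrite -!mulrA -mulrDr -!intrM -intrD (mulrC x%:Z) (mulrC #|V|%:Z) uv mulr1.
  by rewrite expiD (expiMz u tau_x) (expiMz v tau_n) mul1r.
have dom := dominating_pair X_connected ab nk k0n k_ann.
apply: (double_coneP ab _ dom).
by apply: (nonadjacent_pair ab vU zeta1 _ dom); have [_] := k_eig _ nk.
Qed.
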